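(* Let $L$ be a completely regular frame. (1) $\mathrm{Coz}\,L=D_\infty\mathrm{Coz}\,L=L$ if and only if $L$ is perfectly normal. (2) $\mathrm{Coz}\,L=D_\infty\mathrm{Coz}\,L=\mathfrak{B}L$ if and only if $L$ is an extremally disconnected P-frame.
   Context: For a frame $L$, $a^*$ denotes the pseudocomplement of $a$, $CL$ the Boolean algebra of complemented elements, and $\mathfrak{B}L=\{x\in L:x=x^{**}\}$. $x\prec\!\!\prec y$ (completely below) means there are $c_q$ ($q\in\mathbb{Q}\cap[0,1]$) with $c_0=x$, $c_1=y$, and $c_p^*\vee c_q=1$ for $p<q$. For completely regular $L$, $\mathrm{Coz}\,L$ is the sub-$\sigma$-frame of cozero elements, i.e. elements of the form $\bigvee\{a_n:n\in\mathbb{N}\}$ with $a_n\prec\!\!\prec a_{n+1}$ for all $n$; it is a base of $L$. $L$ is perfectly normal if $L=\mathrm{Coz}\,L$; a P-frame if $\mathrm{Coz}\,L=CL$; extremally disconnected if $a^*\vee a^{**}=1$ for all $a\in L$, equivalently $\mathfrak{B}L=CL$. For a meet-semilattice $A$, a subset $G\subseteq A$ is admissible if $\bigvee G$ exists in $A$ and for each $a\in A$ the join $\bigvee\{a\wedge y:y\in G\}$ exists in $A$ and equals $a\wedge\bigvee G$; a downset $E$ of $A$ is a D-ideal if $\bigvee G\in E$ for each admissible $G\subseteq E$; $D_\infty A$ is the frame of D-ideals under inclusion. When $A$ is a base of $L$ closed under binary meets, $D_\infty A$ is identified with the sublocale $\{x\in L:\{a\in A:a\le x\}\text{ is a D-ideal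 of }A\}$ of $L$ (which contains $A$); this is applied to $A=\mathrm{Coz}\,L$. *)

(* Defs.v *)
From HB Require Import structures.
From mathcomp Require Import all_boot all_order all_algebra.
From mathcomp Require Import classical_sets.

Set Implicit Arguments.
Unset Strict Implicit.
Unset Printing Implicit Defensive.

Import Order.TTheory GRing.Theory Num.Theory.

Local Open Scope classical_set_scope.
Local Open Scope order_scope.

HB.mixin Record TBLattice_isFrame d T of Order.TBLattice d T := {
  fsup : set T -> T;
  fsup_isLub : forall A : set T, isLub A (fsup A);
  meet_fsupr : forall (a : T) (A : set T),
    Order.meet a (fsup A) = fsup [set Order.meet a x | x in A]
}.

#[short(type="frameType")]
HB.structure Definition Frame d :=
  { T of Order.TBLattice d T & TBLattice_isFrame d T }.

Section FrameNotions.
Context {d : Order.disp_t} {L : frameType d}.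
Implicit Types (a b x y : L).

Definition pcompl a : L := fsup [set x : L | Order.meet a x = \bot].

Definition complemented : set L :=
  [set a | exists b : L, Order.meet a b = \bot /\ Order.join a b = \top].

(* The Booleanization of L, as a subset of L. *)
Definition booleanization : set L := [set x | x = pcompl (pcompl x)].

(* Only the values of c on [0, 1] matter. *)
Definition completely_below x y : Prop :=
  exists c : rat -> L,
    [/\ c 0%R = x, c 1%R = y &
        forall p q : rat, (0 <= p)%R -> (p < q)%R -> (q <= 1)%R ->
          Order.join (pcompl (c p)) (c q) = \top].

Definition coz : set L :=
  [set x | exists a : nat -> L,
     (forall n, completely_below (a n) (a n.+1)) /\ x = fsup (range a)].

End FrameNotions.

Arguments complemented {d} L.
Arguments booleanization {d} L.
Arguments coz {d} L.

Definition completely_regular d (L : frameType d) : Prop :=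
  forall a : L, a = fsup [set x : L | completely_below x a].

Definition perfectly_normal d (L : frameType d) : Prop := coz L = [set: L].

Definition P_frame d (L : frameType d) : Prop := coz L = complemented L.

Definition extremally_disconnected d (L : frameType d) : Prop :=
  forall a : L, Order.join (pcompl a) (pcompl (pcompl a)) = \top.

(* A meet-semilattice A is presented as a subset, closed under binary meets,
   of an ambient meet-semilattice T: the order and the meets of A are those of
   T, but joins are computed in A. *)
Section DIdeals.
Context {d : Order.disp_t} {T : meetSemilatticeType d}.
Implicit Types (A G E : set T) (s : T).

Definition join_in A G s : Prop :=
  [/\ A s, ubound G s & forall u, A u -> ubound G u -> s <= u].

Definition admissible A G : Prop :=
  G `<=` A /\
  exists s, join_in A G s /\
    forall a, A a -> join_in A [set Order.meet a y | y in G] (Order.meet a s).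

Definition D_ideal A E : Prop :=
  [/\ E `<=` A,
      forall a b, A a -> E b -> a <= b -> E a &
      forall G s, G `<=` E -> admissible A G -> join_in A G s -> E s].

End DIdeals.

(* The frame of D-ideals of A, for A a base of L closed under binary meets,
   identified with a sublocale of L. *)
Definition D_infty d (L : frameType d) (A : set L) : set L :=
  [set x | D_ideal A [set a | A a /\ a <= x]].

(* Coz L is closed under binary meets, so that it is a legitimate argument of
   D_infty. *)
Section CozMeet.
Context {d : Order.disp_t} {L : frameType d}.
Implicit Types (a b x y z : L).

Lemma fsup_ub (A : set L) x : A x -> x <= fsup A.
Proof. by case: (fsup_isLub A) => ub _; exact: ub. Qed.

Lemma fsup_le (A : set L) y : ubound A y -> fsup A <= y.
Proof. by case: (fsup_isLub A) => _; apply. Qed.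

Lemma pcomplP a x : (x <= pcompl a) = (Order.meet a x == \bot).
Proof.
apply/idP/eqP => [xa|ax]; last exact: fsup_ub.
apply/eqP; rewrite -lex0; apply: le_trans (leI2 (lexx a) xa) _.
rewrite meet_fsupr; apply: fsup_le => _ [y ay <-].
by rewrite ay.
Qed.

Lemma pcompl_le a b : a <= b -> pcompl b <= pcompl a.
Proof.
move=> ab; rewrite pcomplP -lex0.
have /eqP <- : Order.meet b (pcompl b) == \bot by rewrite -pcomplP.
exact: leI2.
Qed.

Lemma fsup_set2 x y : fsup [set x; y] = Order.join x y.
Proof.
apply/le_anti/andP; split.
  by apply: fsup_le => z [->|->]; rewrite ?leUl ?leUr.
by rewrite leUx !fsup_ub //=; [right|left].
Qed.

Lemma frame_meetUr x y z :
  Order.meet x (Order.join y z) = Order.join (Order.meet x y) (Order.meet x z).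
Proof. by rewrite -fsup_set2 meet_fsupr image_setU !image_set1 fsup_set2. Qed.

Lemma completely_belowI x y x' y' :
  completely_below x y -> completely_below x' y' ->
  completely_below (Order.meet x x') (Order.meet y y').
Proof.
move=> [c [c0 c1 cP]] [c' [c'0 c'1 c'P]].
exists (fun q => Order.meet (c q) (c' q)); split; rewrite ?c0 ?c1 ?c'0 ?c'1 //.
move=> p q p0 pq q1; apply/eqP; rewrite -le1x.
set w := pcompl _.
have cw : pcompl (c p) <= w by apply: pcompl_le; rewrite leIl.
have c'w : pcompl (c' p) <= w by apply: pcompl_le; rewrite leIr.
have wc : Order.join w (c q) = \top.
  by apply/eqP; rewrite -le1x -(cP p q p0 pq q1) leU2.
have wc' : Order.join w (c' q) = \top.
  by apply/eqP; rewrite -le1x -(c'P p q p0 pq q1) leU2.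
rewrite -[X in X <= _]meet1x -{1}wc meetC frame_meetUr leUx !meet1x leUl /=.
rewrite -[X in X <= _]meet1x -wc' meetC frame_meetUr leUx.
rewrite (le_trans (leIr _ _) (leUl _ _)) /=.
exact: leUr.
Qed.

Lemma completely_below_le x y : completely_below x y -> x <= y.
Proof.
move=> [c [<- <- /(_ 0%R 1%R (lexx _) ltr01 (lexx _)) c01]].
rewrite -[leLHS]meetx1 -c01 frame_meetUr leUx leIr andbT.
have /eqP -> : Order.meet (c 0%R) (pcompl (c 0%R)) == \bot by rewrite -pcomplP.
exact: le0x.
Qed.

Lemma cozI x y : coz L x -> coz L y -> coz L (Order.meet x y).
Proof.
move=> [a [aP ->]] [b [bP ->]].
have homo_a : {homo a : m n / (m <= n)%N >-> m <= n}.
  by apply: homo_leq => [//|? ? ?|n]; [exact: le_trans|exact/completely_below_le].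
have homo_b : {homo b : m n / (m <= n)%N >-> m <= n}.
  by apply: homo_leq => [//|? ? ?|n]; [exact: le_trans|exact/completely_below_le].
exists (fun n => Order.meet (a n) (b n)); split=> [n|].
  exact: completely_belowI.
apply/le_anti/andP; split; last first.
  by apply: fsup_le => _ [n _ <-]; apply: leI2; apply: fsup_ub; exists n.
rewrite meet_fsupr; apply: fsup_le => _ [_ [n _ <-] <-].
rewrite meetC meet_fsupr; apply: fsup_le => _ [_ [m _ <-] <-].
have ub : Order.meet (a (maxn m n)) (b (maxn m n))
    <= fsup (range (fun k => Order.meet (a k) (b k))).
  by apply: fsup_ub; exists (maxn m n).
apply: le_trans ub; rewrite meetC.
by apply: leI2; [apply: homo_a; rewrite leq_maxl|apply: homo_b; rewrite leq_maxr].
Qed.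

End CozMeet.

(* Main.v *)
Require Import Defs.
From mathcomp Require Import all_boot all_order all_algebra.
From mathcomp Require Import classical_sets.
Import Order.TTheory Num.Theory.
Local Open Scope classical_set_scope.

(** For every completely regular [L] the cozero part lies in
    [D_infty (coz L)], since a principal downset of [A] is closed under all
    joins of [A] ([sub_D_infty]). This settles (1).

    In (2), suppose first that the cozero elements are exactly the regular ones
    [x = x**]. For any [a], both [a*] and [a**] are regular, hence cozero, and
    so is their join because cozero elements are closed under binary joins
    ([cozU]). So [a* \/ a**] is regular; being dense, it is [1]. Thus [L] is
    extremally disconnected, where regular and complemented elements coincide
    ([booleanization_complemented]), and [L] is a P-frame.

    Conversely, in an extremally disconnected P-frame cozero, complemented and
    regular elements are the same, and only [D_infty (coz L) `<=` coz L]
    needs an argument ([D_infty_booleanization]). Every [x] is the join in [L]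
    of the regular elements below it, because [y] completely below [x] gives
    [y <= y** <= x] ([completely_below_pcompl2]). In the Boolean algebra of
    regular elements this family has join [x**], and it is admissible. If the
    regular elements below [x] form a D-ideal, then [x**] is one of them, so
    [x] is regular. *)

Section Pseudocomplement.
Set Implicit Arguments.
Unset Strict Implicit.
Context {d : Order.disp_t} {L : frameType d}.
Implicit Types (a b x y u : L).
Local Open Scope order_scope.

Lemma meet_pcompl a : Order.meet a (pcompl a) = \bot.
Proof. by apply/eqP; rewrite -pcomplP. Qed.

Lemma le_pcompl2 a : a <= pcompl (pcompl a).
Proof. by rewrite pcomplP meetC meet_pcompl. Qed.

Lemma pcompl3 a : pcompl (pcompl (pcompl a)) = pcompl a.
Proof. by apply/le_anti; rewrite le_pcompl2 pcompl_le // le_pcompl2. Qed.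

Lemma booleanization_pcompl a : booleanization L (pcompl a).
Proof. by rewrite /booleanization /= pcompl3. Qed.

Lemma pcompl2_le x u : booleanization L u -> x <= u -> pcompl (pcompl x) <= u.
Proof. by move=> {2}-> xu; apply: pcompl_le; apply: pcompl_le. Qed.

(** For regular [u], [a /\ x <= u] says that [x] lies below the regular element
    [(a /\ u* )*], and then [x**] does too. *)
Lemma meet_pcompl2_le a x u : booleanization L u ->
  Order.meet a x <= u -> Order.meet a (pcompl (pcompl x)) <= u.
Proof.
move=> uB axu.
have xw : x <= pcompl (Order.meet a (pcompl u)).
  rewrite pcomplP meetAC -lex0 -(meet_pcompl u).
  exact: leI2.
have := pcompl2_le (booleanization_pcompl _) xw.
by rewrite pcomplP meetAC => h; rewrite uB pcomplP meetC.
Qed.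

(** An element disjoint from [a] and [a*] lies below both [a*] and [a**], which
    are disjoint, so [a \/ a*] is dense. *)
Lemma pcompl2_join_pcompl a :
  pcompl (pcompl (Order.join a (pcompl a))) = \top.
Proof.
set w := Order.join _ _.
have w0 : pcompl w = \bot.
  apply/eqP; rewrite -lex0 -(meet_pcompl (pcompl a)) lexI.
  by rewrite !pcompl_le ?leUl ?leUr.
by apply/eqP; rewrite -le1x pcomplP w0 meet0x.
Qed.

Lemma complemented_pcompl a :
  complemented L a -> Order.join a (pcompl a) = \top.
Proof.
move=> [b [ab0 ab1]]; apply/eqP; rewrite -le1x -ab1 leU2 //.
by rewrite pcomplP ab0.
Qed.

Lemma le_of_join_top a b x :
  Order.join a b = \top -> Order.meet x a = \bot -> x <= b.
Proof.
by move=> ab1 xa0; rewrite -[x]meetx1 -ab1 frame_meetUr xa0 join0x leIr.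
Qed.

Lemma complemented_booleanization : complemented L `<=` booleanization L.
Proof.
move=> a aC; apply/le_anti; rewrite le_pcompl2 /=.
apply: (le_of_join_top (a := pcompl a)); last by rewrite meetC meet_pcompl.
by rewrite joinC complemented_pcompl.
Qed.

Lemma booleanization_complemented :
  extremally_disconnected L -> booleanization L = complemented L.
Proof.
move=> ed; apply/seteqP; split; last exact: complemented_booleanization.
move=> a aB; exists (pcompl a); split; first exact: meet_pcompl.
by rewrite {1}aB joinC ed.
Qed.

End Pseudocomplement.

Section Cozero.
Set Implicit Arguments.
Unset Strict Implicit.
Context {d : Order.disp_t} {L : frameType d}.
Implicit Types (a b x y : L).
Local Open Scope order_scope.

Lemma completely_below_pcompl2 x y :
  completely_below x y -> pcompl (pcompl x) <= y.
Proof.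
move=> [c [<- <- cP]].
apply: (le_of_join_top (a := pcompl (c 0%R))); first exact: cP.
by rewrite meetC meet_pcompl.
Qed.

Lemma completely_belowU x y x' y' :
  completely_below x y -> completely_below x' y' ->
  completely_below (Order.join x x') (Order.join y y').
Proof.
move=> [c [c0 c1 cP]] [c' [c'0 c'1 c'P]].
exists (fun q => Order.join (c q) (c' q)); split; rewrite ?c0 ?c1 ?c'0 ?c'1 //.
move=> p q p0 pq q1; set w := pcompl _; set v := Order.join _ (c' q).
have meet_w : Order.meet (pcompl (c p)) (pcompl (c' p)) <= w.
  rewrite pcomplP meetC frame_meetUr -lex0 leUx; apply/andP; split.
    by rewrite -(meet_pcompl (c p)) [leRHS]meetC leI2 ?leIl.
  by rewrite -(meet_pcompl (c' p)) [leRHS]meetC leI2 ?leIr.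
(* The two covers of the top are met together, distributing one at a time. *)
have cw : pcompl (c p) <= Order.join w v.
  rewrite -[leLHS]meetx1 -(c'P p q p0 pq q1) frame_meetUr leUx.
  rewrite (le_trans meet_w (leUl _ _)) /=.
  by apply: le_trans (leIr _ _) _; rewrite joinA leUr.
apply/eqP; rewrite -le1x -(cP p q p0 pq q1) leUx cw /=.
by rewrite /v joinCA leUl.
Qed.

Lemma cozU x y : coz L x -> coz L y -> coz L (Order.join x y).
Proof.
move=> [a [aP ->]] [b [bP ->]].
exists (fun n => Order.join (a n) (b n)); split=> [n|].
  exact: completely_belowU.
apply/le_anti/andP; split.
  rewrite leUx; apply/andP; split; apply: fsup_le => _ [n _ <-].
    apply: le_trans (leUl _ _) (_ : Order.join (a n) (b n) <= _).
    by apply: fsup_ub; exists n.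
  apply: le_trans (leUr _ _) (_ : Order.join (a n) (b n) <= _).
  by apply: fsup_ub; exists n.
by apply: fsup_le => _ [n _ <-]; apply: leU2; apply: fsup_ub; exists n.
Qed.

End Cozero.

Section DInfty.
Set Implicit Arguments.
Unset Strict Implicit.
Context {d : Order.disp_t} {L : frameType d}.
Local Open Scope order_scope.

Lemma sub_D_infty (A : set L) : A `<=` D_infty A.
Proof.
move=> x Ax; split=> [a []//|a b Aa [_ bx] ab|G s Gx _ [As _ s_le]].
  by split=> //; exact: le_trans bx.
by split=> //; apply: s_le => // g /Gx[].
Qed.

(** The regular elements below [x] have join [x] in [L], hence join [x**] among
    the regular ones. Meeting with a regular [a] preserves this join, so a
    D-ideal containing them all contains [x**], whence [x** <= x]. *)
Lemma D_infty_booleanization :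
  completely_regular L -> D_infty (booleanization L) `<=` booleanization L.
Proof.
move=> cr x [_ _ clE].
pose G := [set a : L | booleanization L a /\ a <= x].
have le_bound u : ubound G u -> x <= u.
  move=> Gu; rewrite [x]cr; apply: fsup_le => y yx.
  apply: le_trans (le_pcompl2 y) _; apply: Gu.
  by split; [exact: booleanization_pcompl|exact: completely_below_pcompl2].
have joinG : join_in (booleanization L) G (pcompl (pcompl x)).
  split=> [|a [_ ax]|u uB Gu]; first exact: booleanization_pcompl.
  - exact: le_trans (le_pcompl2 x).
  - exact/pcompl2_le/le_bound.
have [] : G (pcompl (pcompl x)); last first.
  by move=> _ xx; apply/le_anti; rewrite le_pcompl2 xx.
apply: (clE G) => //; split=> [a []//|].
exists (pcompl (pcompl x)); split=> // a aB; split.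
- apply/le_anti; rewrite le_pcompl2 /= lexI; apply/andP; split.
    by apply: pcompl2_le => //; exact: leIl.
  by apply: pcompl2_le; [exact: booleanization_pcompl|exact: leIr].
- move=> _ [y [_ yx] <-]; apply: leI2 => //.
  exact: le_trans (le_pcompl2 x).
- move=> u uB Gu; apply: meet_pcompl2_le => //.
  rewrite [x]cr meet_fsupr; apply: fsup_le => _ [y yx <-].
  apply: (@le_trans _ _ (Order.meet a (pcompl (pcompl y)))).
    by apply: leI2 => //; exact: le_pcompl2.
  apply: Gu; exists (pcompl (pcompl y)) => //; split.
    exact: booleanization_pcompl.
  exact: completely_below_pcompl2.
Qed.

Lemma coz_booleanization_extremally_disconnected :
  coz L = booleanization L -> extremally_disconnected L.
Proof.
move=> cozB a.
have : booleanization L (Order.join (pcompl a) (pcompl (pcompl a))).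
  by rewrite -cozB; apply: cozU; rewrite cozB; exact: booleanization_pcompl.
by move=> ->; exact: pcompl2_join_pcompl.
Qed.

End DInfty.

Theorem proposition7p3 (d : Order.disp_t) (L : frameType d)
    (hL : completely_regular L) :
  (coz L = D_infty (coz L) /\ D_infty (coz L) = [set: L]
     <-> perfectly_normal L) /\
  (coz L = D_infty (coz L) /\ D_infty (coz L) = booleanization L
     <-> extremally_disconnected L /\ P_frame L).
Proof.
split; split.
- by move=> [cozD DT]; rewrite /perfectly_normal cozD.
- rewrite /perfectly_normal => ->.
  have DT : D_infty [set: L] = [set: L].
    by apply/seteqP; split=> // x _; exact: sub_D_infty.
  by rewrite DT.
- move=> [cozD DB]; have cozB : coz L = booleanization L by rewrite cozD.
  have ed := coz_booleanization_extremally_disconnected cozB.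
  by split=> //; rewrite /P_frame cozB booleanization_complemented.
- move=> [ed]; rewrite /P_frame -booleanization_complemented // => ->.
  have DB : D_infty (booleanization L) = booleanization L.
    apply/seteqP; split; first exact: D_infty_booleanization.
    exact: sub_D_infty.
  by rewrite DB.
Qed.
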